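(* Let $n>2$. The volume of the cyclopermutohedron $\mathcal{CP}_{n+1}$ equals zero.
   Context: A virtual polytope in $\mathbb{R}^n$ is a formal Minkowski difference $K-L$ of convex polytopes, where $K_1-L_1$ and $K_2-L_2$ are identified iff $K_1+L_2=K_2+L_1$ (an element of the Grothendieck group of the semigroup of convex polytopes under Minkowski addition; $\bigoplus$ denotes the Minkowski sum). Let $e_1,\dots,e_n$ be the standard basis of $\mathbb{R}^n$, and $e=(1,1,\dots,1)\in\mathbb{R}^n$. Let $R_i=n e_i-e=(-1,\dots,-1,n-1,-1,\dots,-1)$ (with $n-1$ at position $i$). Let $q_{ij}=[e_i,e_j]$ for $1\le i<j\le n$ and $r_i=[0,R_i]$ for $1\le i\le n$ be line segments. The cyclopermutohedron is the virtual polytope $$\mathcal{CP}_{n+1}:=\bigoplus_{1\le i<j\le n} q_{ij}+e-\bigoplus_{i=1}^n r_i .$$ It lies in the hyperplane $x_1+\dots+x_n=\frac{n(n+1)}{2}$ and has dimension $n-1$; its volume means its $(n-1)$-dimensional volume. Volume of a virtual zonotope: let $s_1,\dots,s_m$ be segments with defining vectors (endpoint differences) $v_1,\dots,v_m$, all lying in the hyperplane $\{x_1+\dots+x_n=0\}$. For real $\lambda_1,\dots,\lambda_m\geq 0$ the $(n-1)$-volume of $\bigoplus_i\lambda_i s_i$ is the polynomial $\sum_{J\subset[m],\,|J|=n-1}\ \prod_{j\in J}\lambda_j\cdot \mathrm{Vol}_{n-1}(Z_J)$, where $Z_J$ is the parallelepiped spanned by $\{v_j\}_{j\in J}$ (with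 volume $0$ if these vectors are linearly dependent). For arbitrary real $\lambda_i$, possibly negative, the volume of the virtual zonotope $\bigoplus_i \lambda_i s_i$ is defined as the value of this same polynomial; $-r_i$ corresponds to the coefficient $-1$. Volume is invariant under translation (such as by $e$). *)

(* Defs.v *)
From HB Require Import structures.
From mathcomp Require Import all_boot all_order all_algebra generic_quotient.
From mathcomp Require Import boolp classical_sets reals.

Set Implicit Arguments.
Unset Strict Implicit.
Unset Printing Implicit Defensive.

Import Order.TTheory GRing.Theory Num.Theory.

Local Open Scope classical_set_scope.
Local Open Scope ring_scope.
Local Open Scope quotient_scope.

Section Polytopes.
Variables (R : realType) (n : nat).
Local Notation V := 'rV[R]_n.

Definition conv (I : finType) (p : I -> V) : set V :=
  [set x | exists w : I -> R,
     [/\ forall i, 0 <= w i, \sum_i w i = 1 & x = \sum_i w i *: p i]].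

(* The point [i0] makes polytopes nonempty; without it Minkowski addition is
   not cancellative. *)
Definition is_polytope (K : set V) : Prop :=
  exists (I : finType) (i0 : I) (p : I -> V), K = conv p.

Record polytope := Polytope {
  polytope_set :> set V;
  polytopeP : is_polytope polytope_set }.

HB.instance Definition _ := gen_eqMixin polytope.
HB.instance Definition _ := gen_choiceMixin polytope.

Lemma polytope_eq (K L : polytope) : K = L :> set V -> K = L.
Proof.
case: K L => [K hK] [L hL] /= eKL; subst L.
by congr Polytope; exact: Prop_irrelevance.
Qed.

Definition minkowski (K L : set V) : set V := [set x + y | x in K & y in L].

Lemma minkowski_polytope (K L : polytope) : is_polytope (minkowski K L).
Proof.
case: (polytopeP K) => I [i0 [p ->]]; case: (polytopeP L) => J [j0 [q ->]].
exists (I * J)%type, (i0, j0), (fun ij => p ij.1 + q ij.2).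
apply/seteqP; split=> x /=.
- case=> _ [w [w0 w1 ->]] [_ [z [z0 z1 ->]] <-].
  exists (fun ij => w ij.1 * z ij.2); split.
  + by move=> ij; apply: mulr_ge0.
  + rewrite -(pair_bigA _ (fun i j => w i * z j)) /= -[RHS]w1.
    by apply: eq_bigr => i _; rewrite -mulr_sumr z1 mulr1.
  + rewrite -(pair_bigA _ (fun i j => (w i * z j) *: (p i + q j))) /=.
    have E i : \sum_j (w i * z j) *: (p i + q j)
               = w i *: p i + w i *: \sum_j z j *: q j.
      under eq_bigr => j _ do rewrite scalerDr.
      rewrite big_split /= -scaler_suml -mulr_sumr z1 mulr1 scaler_sumr.
      by congr (_ + _); apply: eq_bigr => j _; rewrite scalerA.
    under [RHS]eq_bigr => i _ do rewrite E.
    by rewrite big_split /= -scaler_suml w1 scale1r.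
- case=> w [w0 w1 ->].
  exists (\sum_i (\sum_j w (i, j)) *: p i).
    exists (fun i => \sum_j w (i, j)); split=> // [i|].
      exact: sumr_ge0.
    by rewrite pair_bigA -[RHS]w1 /=; apply: eq_bigr => -[].
  exists (\sum_j (\sum_i w (i, j)) *: q j).
    exists (fun j => \sum_i w (i, j)); split=> // [j|].
      exact: sumr_ge0.
    by rewrite exchange_big pair_bigA -[RHS]w1 /=; apply: eq_bigr => -[].
  under eq_bigr => i _ do rewrite scaler_suml.
  under [X in _ + X]eq_bigr => i _ do rewrite scaler_suml.
  rewrite [X in _ + X]exchange_big !pair_bigA -big_split /=.
  by apply: eq_bigr => -[i j] _; rewrite scalerDr.
Qed.

Definition padd (K L : polytope) : polytope :=
  Polytope (minkowski_polytope K L).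

Lemma segment_polytope (a b : V) :
  is_polytope (conv (fun t : bool => if t then b else a)).
Proof. by exists bool, true, (fun t : bool => if t then b else a). Qed.

Lemma point_polytope (a : V) : is_polytope [set a].
Proof.
exists unit, tt, (fun=> a); apply/seteqP; split=> x /=.
  move=> ->; exists (fun=> 1); split=> //.
    by rewrite big_const card_unit /= addr0.
  by rewrite big_const card_unit /= addr0 scale1r.
by case=> w [_ w1 ->]; rewrite -scaler_suml w1 scale1r.
Qed.

Definition psegment (a b : V) : polytope := Polytope (segment_polytope a b).
Definition ppoint (a : V) : polytope := Polytope (point_polytope a).

Lemma paddC : commutative padd.
Proof.
move=> K L; apply: polytope_eq; apply/seteqP.
by split=> _ [x hx [y hy <-]]; exists y => //; exists x => //; exact: addrC.
Qed.

Lemma paddA : associative padd.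
Proof.
move=> K L M; apply: polytope_eq; apply/seteqP; split=> v /=.
- case=> x hx [_ [y hy [z hz <-]] <-].
  exists (x + y); first by exists x => //; exists y.
  by exists z => //; rewrite addrA.
- case=> _ [x hx [y hy <-]] [z hz <-].
  exists x => //; exists (y + z); last by rewrite addrA.
  by exists y => //; exists z.
Qed.

Lemma padd0 : left_id (ppoint 0) padd.
Proof.
move=> K; apply: polytope_eq; apply/seteqP; split=> x /=.
  by case=> _ -> [y hy <-]; rewrite add0r.
by move=> hx; exists 0 => //; exists x => //; rewrite add0r.
Qed.

Lemma stationary_distribution (m : nat) (P : 'M[R]_m.+1) :
    (forall i j, 0 <= P i j) -> (forall i, \sum_j P i j = 1) ->
  exists x : 'rV[R]_m.+1,
    [/\ forall j, 0 <= x 0 j, \sum_j x 0 j = 1 & x *m P = x].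
Proof.
move=> P0 P1.
have /det0P[x xN0 xP] : \det (P - 1%:M) == 0.
  rewrite -det_tr; apply/det0P; exists (const_mx 1).
    by apply/eqP => /rowP/(_ 0)/eqP; rewrite !mxE oner_eq0.
  apply/rowP => j; rewrite !mxE.
  under eq_bigr => i _ do rewrite !mxE mul1r.
  rewrite sumrB P1 (bigD1 j) //= eqxx big1 ?addr0 ?subrr // => i ij.
  by rewrite eq_sym (negPf ij).
have {}xP : x *m P = x.
  by apply/eqP; rewrite -subr_eq0 -[X in _ - X]mulmx1 -mulmxBr xP.
have xj j : `|x 0 j| <= \sum_i `|x 0 i| * P i j.
  rewrite -{1}xP mxE; apply: le_trans (ler_norm_sum _ _ _) _.
  by apply: ler_sum => i _; rewrite normrM (ger0_norm (P0 i j)).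
have aP j : \sum_i `|x 0 i| * P i j = `|x 0 j|.
  apply/eqP; rewrite -subr_eq0; apply/eqP.
  have := @psumr_eq0P _ _ xpredT (fun j => \sum_i `|x 0 i| * P i j - `|x 0 j|).
  apply=> // [i _|]; first by rewrite subr_ge0.
  rewrite sumrB exchange_big /= -[X in _ - X]mulr1 mulr_suml -sumrB.
  by apply: big1 => i _; rewrite -mulr_sumr P1 subrr.
pose s := \sum_j `|x 0 j|.
have sN0 : s != 0.
  apply: contra xN0 => /eqP s0; apply/eqP/rowP => j; rewrite mxE.
  by apply/eqP; rewrite -normr_eq0; apply/eqP; apply: (psumr_eq0P _ s0).
exists (\row_j (`|x 0 j| / s)); split.
- by move=> j; rewrite mxE divr_ge0 ?sumr_ge0.
- by under eq_bigr => j _ do rewrite mxE; rewrite -mulr_suml divff.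
- apply/rowP => j; rewrite !mxE -aP mulr_suml.
  by apply: eq_bigr => i _; rewrite mxE mulrAC.
Qed.

Lemma conv_avg (I J : finType) (p : I -> V) (w : J -> R) (l : J -> V) :
    (forall j, 0 <= w j) -> \sum_j w j = 1 -> (forall j, conv p (l j)) ->
  conv p (\sum_j w j *: l j).
Proof.
move=> w0 w1 /choice[z hz].
exists (fun i => \sum_j w j * z j i); split=> [i||].
- by apply: sumr_ge0 => j _; case: (hz j) => z0 _ _; rewrite mulr_ge0.
- rewrite exchange_big /= -[RHS]w1; apply: eq_bigr => j _.
  by case: (hz j) => _ z1 _; rewrite -mulr_sumr z1 mulr1.
- under [RHS]eq_bigr => i _ do rewrite scaler_suml.
  rewrite exchange_big /=; apply: eq_bigr => j _.
  case: (hz j) => _ _ ->; rewrite scaler_sumr.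
  by apply: eq_bigr => i _; rewrite scalerA.
Qed.

(* If k is in K, write k + p j = l j + \sum_i w j i *: p i for every generator
   p j of M and average over a stationary distribution of the stochastic
   matrix w: the p-terms cancel, leaving k as an average of points of L. *)
Lemma padd_cancel_sub (K L M : polytope) :
  minkowski K M `<=` minkowski L M -> (K : set V) `<=` L.
Proof.
case: (polytopeP L) => J [_ [q eL]]; case: (polytopeP M) => I [i0 [p eM]].
rewrite eL eM => sub k Kk.
have cardI : #|I| = #|I|.-1.+1 by rewrite prednK //; apply/card_gt0P; exists i0.
pose e (i : 'I_(#|I|.-1.+1)) : I := enum_val (cast_ord (esym cardI) i).
have e_bij : bijective e.
  apply: bij_comp; first exact: enum_val_bij.
  by exists (cast_ord cardI) => i; [exact: cast_ordKV|exact: cast_ordK].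
have [g eK gK] := e_bij.
have reindexE (T : nmodType) (F : I -> T) : \sum_i F i = \sum_j F (e j).
  by rewrite (reindex e) //; exists g => ? _; [exact: eK|exact: gK].
have pM i : conv p (p i).
  exists (fun j => (j == i)%:R); split=> [j||].
  - exact: ler0n.
  - by rewrite (bigD1 i) //= eqxx big1 ?addr0 // => j /negPf->.
  - rewrite (bigD1 i) //= eqxx scale1r big1 ?addr0 // => j /negPf->.
    by rewrite scale0r.
have /choice[l /choice[w hw]] (j : 'I_(#|I|.-1.+1)) : exists l (w : I -> R),
    [/\ conv q l, forall i, 0 <= w i, \sum_i w i = 1 &
        k + p (e j) = l + \sum_i w i *: p i].
  have /sub [l Ll [_ [w [w0 w1 ->]] E]] : minkowski K (conv p) (k + p (e j)).
    by exists k => //; exists (p (e j)).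
  by exists l, w.
have [x [x0 x1 xP]] : exists x : 'rV[R]_(#|I|.-1.+1),
    [/\ forall j, 0 <= x 0 j, \sum_j x 0 j = 1 &
        x *m (\matrix_(i, j) w i (e j)) = x].
  apply: stationary_distribution => i; first by move=> j; rewrite mxE; case: (hw i).
  under eq_bigr => j _ do rewrite mxE.
  by rewrite -reindexE; case: (hw i).
suff -> : k = \sum_j x 0 j *: l j.
  by apply: conv_avg => // j; case: (hw j).
apply: (@addIr _ (\sum_j x 0 j *: p (e j))).
rewrite -[in LHS](scale1r k) -x1 scaler_suml -big_split /=.
under eq_bigr => j _.
  rewrite -scalerDr; case: (hw j) => _ _ _ ->; rewrite scalerDr reindexE.
  over.
rewrite big_split /=; congr (_ + _).
under eq_bigr => j _ do rewrite scaler_sumr.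
rewrite exchange_big /=; apply: eq_bigr => j _.
rewrite -[in RHS]xP mxE scaler_suml.
by apply: eq_bigr => i _; rewrite mxE scalerA.
Qed.

Lemma padd_cancel (M : polytope) : injective (fun K => padd K M).
Proof.
move=> K L /(congr1 polytope_set) /= E; apply: polytope_eq.
by apply/seteqP; split; apply: (@padd_cancel_sub _ _ M) => x; rewrite E.
Qed.

Definition vequiv (P Q : polytope * polytope) : bool :=
  padd P.1 Q.2 == padd Q.1 P.2.

Lemma vequiv_refl : reflexive vequiv.
Proof. by move=> P; rewrite /vequiv. Qed.

Lemma vequiv_sym : symmetric vequiv.
Proof. by move=> P Q; rewrite /vequiv eq_sym. Qed.

Lemma vequiv_trans : transitive vequiv.
Proof.
move=> Q P S /eqP PQ /eqP QS; apply/eqP; apply: (@padd_cancel Q.2).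
by rewrite -paddA (paddC S.2) paddA PQ -paddA (paddC P.2) paddA QS -!paddA
           (paddC Q.2).
Qed.

Canonical vequiv_equiv := EquivRel vequiv vequiv_refl vequiv_sym vequiv_trans.

Definition virtual_polytope := {eq_quot vequiv}.

HB.instance Definition _ : EqQuotient _ vequiv virtual_polytope :=
  EqQuotient.on virtual_polytope.
HB.instance Definition _ := Choice.on virtual_polytope.

Definition vdiff (K L : polytope) : virtual_polytope :=
  \pi_virtual_polytope (K, L).

Lemma vdiff_eq (K1 L1 K2 L2 : polytope) :
  vdiff K1 L1 = vdiff K2 L2 <-> padd K1 L2 = padd K2 L1.
Proof. by split=> [/eqmodP/eqP //|E]; apply/eqmodP/eqP. Qed.

Lemma vdiffW (T : virtual_polytope -> Prop) :
  (forall K L, T (vdiff K L)) -> forall P, T P.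
Proof. by move=> h; elim/quotW => -[K L]; exact: h. Qed.

Definition vadd (P Q : virtual_polytope) : virtual_polytope :=
  vdiff (padd (repr P).1 (repr Q).1) (padd (repr P).2 (repr Q).2).
Definition vopp (P : virtual_polytope) : virtual_polytope :=
  vdiff (repr P).2 (repr P).1.

Lemma repr_vdiff (K L : polytope) :
  padd (repr (vdiff K L)).1 L = padd K (repr (vdiff K L)).2.
Proof. by apply/vdiff_eq; rewrite /vdiff -surjective_pairing reprK. Qed.

Lemma paddACA : interchange padd padd.
Proof. by move=> A B C D; rewrite -!paddA (paddA B) (paddC B C) -(paddA C). Qed.

Lemma vadd_diff (K1 L1 K2 L2 : polytope) :
  vadd (vdiff K1 L1) (vdiff K2 L2) = vdiff (padd K1 K2) (padd L1 L2).
Proof. by apply/vdiff_eq; rewrite paddACA !repr_vdiff paddACA. Qed.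

Lemma vopp_diff (K L : polytope) : vopp (vdiff K L) = vdiff L K.
Proof. by apply/vdiff_eq; rewrite paddC -repr_vdiff paddC. Qed.

Lemma vaddA : associative vadd.
Proof.
by do 3![elim/vdiffW=> ? ?]; rewrite !vadd_diff !paddA.
Qed.

Lemma vaddC : commutative vadd.
Proof. by do 2![elim/vdiffW=> ? ?]; rewrite !vadd_diff; congr vdiff; exact: paddC. Qed.

Lemma vadd0 : left_id (vdiff (ppoint 0) (ppoint 0)) vadd.
Proof. by elim/vdiffW=> ? ?; rewrite vadd_diff !padd0. Qed.

Lemma vaddN : left_inverse (vdiff (ppoint 0) (ppoint 0)) vopp vadd.
Proof.
elim/vdiffW=> K L; rewrite vopp_diff vadd_diff; apply/vdiff_eq.
by rewrite paddC !padd0 paddC.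
Qed.

HB.instance Definition _ :=
  GRing.isZmodule.Build virtual_polytope vaddA vaddC vadd0 vaddN.

Definition vpoly (K : polytope) : virtual_polytope := vdiff K (ppoint 0).

Lemma vdiffE (K L : polytope) : vdiff K L = vpoly K - vpoly L.
Proof.
rewrite /vpoly; change (vdiff K L =
  vadd (vdiff K (ppoint 0)) (vopp (vdiff L (ppoint 0)))).
by rewrite vopp_diff vadd_diff padd0 paddC padd0.
Qed.

Lemma vpolyD (K L : polytope) : vpoly (padd K L) = vpoly K + vpoly L.
Proof.
change (vpoly (padd K L) = vadd (vpoly K) (vpoly L)).
by rewrite vadd_diff padd0.
Qed.

Definition vsegment (a b : V) : virtual_polytope := vpoly (psegment a b).
Definition vpoint (a : V) : virtual_polytope := vpoly (ppoint a).

Definition vscaled_segment (c : R) (a b : V) : virtual_polytope :=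
  if 0 <= c then vsegment (c *: a) (c *: b)
  else - vsegment (- c *: a) (- c *: b).

(* A presentation shift + \bigoplus_i coef_i [src_i, tgt_i] of a virtual
   zonotope; [vz_hyperplane] puts the defining vectors tgt_i - src_i in
   {x | x_1 + .. + x_n = 0}. *)
Record virtual_zonotope := VirtualZonotope {
  vz_index : finType;
  vz_coef : vz_index -> R;
  vz_src : vz_index -> V;
  vz_tgt : vz_index -> V;
  vz_shift : V;
  vz_hyperplane : forall i, \sum_k (vz_tgt i - vz_src i) 0 k = 0 }.

Definition vz_vector (Z : virtual_zonotope) (i : vz_index Z) : V :=
  vz_tgt i - vz_src i.

Definition vz_polytope (Z : virtual_zonotope) : virtual_polytope :=
  vpoint (vz_shift Z) +
  \sum_(i : vz_index Z) vscaled_segment (vz_coef i) (vz_src i) (vz_tgt i).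

(* k-dimensional volume, in R^n, of the parallelepiped spanned by the k rows
   of A: the square root of the Gram determinant of the rows (0 when they are
   linearly dependent). *)
Definition parallelepiped_volume (k : nat) (A : 'M[R]_(k, n)) : R :=
  Num.sqrt (\det (A *m A^T)).

(* The volume polynomial of a zonotope evaluated at the coefficients of Z, which
   may be negative; the shift plays no role. *)
Definition vz_volume (Z : virtual_zonotope) : R :=
  \sum_(J : {set vz_index Z} | #|J| == n.-1)
    (\prod_(j in J) vz_coef j) *
    parallelepiped_volume (\matrix_(i < #|J|) vz_vector (enum_val i)).

Definition basis_vec (i : 'I_n) : V := delta_mx 0 i.
Definition all_ones : V := const_mx 1.
Definition Rvec (i : 'I_n) : V := n%:R *: basis_vec i - all_ones.

(* Index type of the segments: [inl] (i, j) with i < j for q_ij, [inr] i for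
   r_i. *)
Definition cp_index : finType :=
  ({ij : 'I_n * 'I_n | (ij.1 < ij.2)%N} + 'I_n)%type.

Definition cp_coef (s : cp_index) : R := if s is inl _ then 1 else -1.
Definition cp_src (s : cp_index) : V :=
  if s is inl ij then basis_vec (val ij).1 else 0.
Definition cp_tgt (s : cp_index) : V :=
  match s with inl ij => basis_vec (val ij).2 | inr i => Rvec i end.

Lemma cp_hyperplane (s : cp_index) : \sum_k (cp_tgt s - cp_src s) 0 k = 0.
Proof.
pose total (v : V) := \sum_k v 0 k.
have totalB u v : total (u - v) = total u - total v.
  by rewrite -sumrB; apply: eq_bigr => k _; rewrite !mxE.
have total_basis i : total (basis_vec i) = 1.
  rewrite /total (bigD1 i) //= mxE !eqxx big1 ?addr0 // => k.
  by rewrite mxE eqxx => /negPf->.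
rewrite -/(total _); case: s => [ij|i] /=; first by rewrite totalB !total_basis subrr.
have totalZ c v : total (c *: v) = c * total v.
  by rewrite mulr_sumr; apply: eq_bigr => k _; rewrite mxE.
have total1 : total all_ones = n%:R.
  rewrite /total; under eq_bigr => k _ do rewrite mxE.
  by rewrite sumr_const card_ord.
by rewrite subr0 totalB totalZ total_basis mulr1 total1 subrr.
Qed.

(* Presentation of CP_{n+1}; lemma [cyclopermutohedronE] identifies the virtual
   polytope it presents. *)
Definition cyclopermutohedron : virtual_zonotope :=
  VirtualZonotope cp_coef all_ones cp_hyperplane.

Lemma cyclopermutohedronE :
  vz_polytope cyclopermutohedron =
    \sum_(i : 'I_n) \sum_(j : 'I_n | (i < j)%N)
       vsegment (basis_vec i) (basis_vec j)
    + vpoint all_ones - \sum_(i : 'I_n) vsegment 0 (Rvec i).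
Proof.
rewrite /vz_polytope /= big_sumType /= addrA; congr (_ + _).
  rewrite addrC; congr (_ + _); rewrite pair_big_dep /=.
  rewrite (reindex_omap (fun x : {ij : 'I_n * 'I_n | (ij.1 < ij.2)%N} => val x)
             insub) /=; last by move=> x hx; rewrite insubT.
  apply: eq_big => [[x hx]|x _] /=; first by rewrite insubT eqxx hx.
  by rewrite /vscaled_segment /= ler01 !scale1r.
rewrite -sumrN; apply: eq_bigr => i _.
by rewrite /vscaled_segment /= oppr_ge0 ler10 opprK !scale1r.
Qed.

End Polytopes.

(* Main.v *)
Require Import Defs.
From mathcomp Require Import all_boot all_order all_algebra all_fingroup.
From mathcomp Require Import ring reals.
Import GRing.Theory Num.Theory.
Local Open Scope ring_scope.
Set Implicit Arguments.
Unset Strict Implicit.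
Unset Printing Implicit Defensive.

(** Let [ones] be the row of 1s, of length n.  A set J of n - 1 segments is a
    set T of edges, with vectors e_j - e_i, together with a set I of vertices,
    with vectors R_i = n e_i - [ones].  As all these vectors are orthogonal to
    [ones], a vector of norm sqrt n, the volume of the parallelepiped of J is
    1 / sqrt n times the absolute value of the determinant with [ones] as an
    extra row ([det_gram_ones]).  Adding multiples of that row turns R_i into
    n e_i, so that this determinant is n ^ #|I| times the one in which every
    R_i is replaced by e_i ([det_ones_shear]).

    The rows that remain are rows of a network matrix: a +1 and a -1 at most.
    Such matrices are totally unimodular ([det_network]).  Expand the
    determinant along the row of 1s: the n cofactors lie in {-1, 0, 1}, and so
    do their differences, which are determinants of network matrices as well
    (the extra row becomes e_m - e_m').  Hence the nonzero cofactors all have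
    the same sign, and the absolute value of their sum is the sum of their
    squares ([normr_det_ones_network]).  This replaces absolute values by
    squares of maximal minors, to which the Cauchy-Binet formula applies.

    Up to the factor sqrt n, the volume of the cyclopermutohedron is therefore
    the sum over m of
      \sum_J (-n) ^ #|I| (minor of J without column m) ^ 2,
    that is, by [cauchy_binet], the determinant without row and column m of
      \sum_(i < j) (e_j - e_i)^T (e_j - e_i) - n \sum_i e_i^T e_i.
    The first sum is the Laplacian of the complete graph, n times the identity
    minus the matrix of 1s; so the difference has all its entries equal to -1
    ([cp_sum_dyads]), and its minors of size n - 1 >= 2 vanish. *)

(** * The Cauchy-Binet formula for weighted sums of dyads *)

Section CauchyBinet.
Variables (R : numDomainType) (S : finType) (k : nat).
Implicit Types (w : S -> R) (b : S -> 'rV[R]_k).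

Definition gram b (J : {set S}) : 'M[R]_k := \sum_(s in J) (b s)^T *m b s.

Lemma det_sum_dyads w b :
  \det (\sum_s w s *: ((b s)^T *m b s)) =
  \sum_(f : {ffun 'I_k -> S}) (\prod_i w (f i)) * (\prod_i b (f i) 0 i)
                              * \det (\matrix_i b (f i)).
Proof.
have entry i j : (\sum_s w s *: ((b s)^T *m b s)) i j =
    \sum_s w s * (b s 0 i * b s 0 j).
  rewrite summxE; apply: eq_bigr => s _.
  by rewrite !mxE big_ord1 !mxE.
under [RHS]eq_bigr => f _ do rewrite /determinant big_distrr /=.
rewrite exchange_big /=; apply: eq_bigr => s _.
under eq_bigr => i _ do rewrite entry.
rewrite bigA_distr_bigA big_distrr /=; apply: eq_bigr => f _.
rewrite [RHS]mulrCA; congr (_ * _).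
by rewrite -!big_split /=; apply: eq_bigr => i _; rewrite mxE mulrA.
Qed.

(** The determinant is invariant under permutations of the index i of the
    functions f in [det_sum_dyads] up to a sign; averaging over the k! of them
    turns the product of the entries b (f i) 0 i into a second copy of the
    determinant. *)
Lemma fact_det_sum_dyads w b :
  k`!%:R * \det (\sum_s w s *: ((b s)^T *m b s)) =
  \sum_(f : {ffun 'I_k -> S}) (\prod_i w (f i)) *
                              (\det (\matrix_i b (f i))) ^+ 2.
Proof.
transitivity (\sum_(s : 'S_k) \sum_(f : {ffun 'I_k -> S})
  (\prod_i w (f i)) * ((-1) ^+ s * \prod_i b (f i) 0 (s i)) *
  \det (\matrix_i b (f i))); last first.
  rewrite exchange_big /=; apply: eq_bigr => f _.
  rewrite expr2 mulrA -mulr_suml -mulr_sumr; congr (_ * _ * _).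
  by apply: eq_bigr => s _; congr (_ * _); apply: eq_bigr => i _; rewrite mxE.
rewrite -card_Sn mulr_natl -sumr_const.
apply: eq_big => [s|s _]; first by rewrite inE.
rewrite det_sum_dyads.
(* Reindexing the functions f by f \o s^-1 moves s from f to the columns. *)
have bij : {on [pred _ | true], bijective
    (fun f : {ffun 'I_k -> S} => [ffun i => f ((s^-1)%g i)])}.
  by exists (fun f => [ffun i => f (s i)]) => f _; apply/ffunP => i;
     rewrite !ffunE ?permK ?permKV.
rewrite (reindex _ bij) /=.
apply: eq_bigr => f _.
have reindex_s (F : 'I_k -> S -> R) :
    \prod_i F i ([ffun i0 => f ((s^-1)%g i0)] i) = \prod_i F (s i) (f i).
  rewrite (reindex_inj (@perm_inj _ s)).
  by apply: eq_bigr => i _; rewrite ffunE permK.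
rewrite (reindex_s (fun=> w)) (reindex_s (fun i t => b t 0 i)).
rewrite -!mulrA; congr (_ * _).
rewrite mulrCA; congr (_ * _).
have -> : \matrix_i b ([ffun i0 => f ((s^-1)%g i0)] i) =
          perm_mx (s^-1)%g *m \matrix_i b (f i).
  by rewrite -row_permE; apply/matrixP => i j; rewrite !mxE ffunE.
by rewrite det_mulmx det_perm odd_permV.
Qed.

(** The squared minor of the rows b s, s in J, does not depend on the order in
    which f lists J, since it is the determinant of a sum over J. *)
Lemma det_sqr_gram b (J : {set S}) (f : {ffun 'I_k -> S}) :
  f @: 'I_k = J -> injective f ->
  (\det (\matrix_i b (f i))) ^+ 2 = \det (gram b J).
Proof.
move=> <- f_inj; rewrite expr2 -{1}det_tr -det_mulmx; congr (\det _).
apply/matrixP => i j; rewrite /gram big_imset /=.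
  2: by move=> ? ? _ _; exact: f_inj.
rewrite !mxE summxE; apply: eq_bigr => l _.
by rewrite !mxE big_ord1 !mxE.
Qed.

(** The squared minors of the Cauchy-Binet formula appear as \det (gram b J), by
    [det_sqr_gram].  Of the functions f in [fact_det_sum_dyads], those that are
    not injective repeat a row, and each J is the image of k! injective ones. *)
Lemma cauchy_binet w b :
  \det (\sum_s w s *: ((b s)^T *m b s)) =
  \sum_(J : {set S} | #|J| == k) (\prod_(s in J) w s) * \det (gram b J).
Proof.
have kF : k`!%:R != 0 :> R by rewrite pnatr_eq0 -lt0n fact_gt0.
apply: (mulfI kF); rewrite fact_det_sum_dyads.
rewrite (bigID (fun f : {ffun 'I_k -> S} => injectiveb f)) /=.
rewrite addrC big1 ?add0r; last first.
  move=> f /injectivePn[i [j ij fij]].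
  rewrite (determinant_alternate ij) ?expr0n ?mulr0 // => l.
  by rewrite !mxE fij.
rewrite (partition_big (fun f : {ffun 'I_k -> S} => f @: 'I_k)
  (fun J : {set S} => #|J| == k)) /=; last first.
  by move=> f /injectiveP fi; rewrite card_imset // card_ord.
rewrite mulr_sumr; apply: eq_bigr => J /eqP cJ.
rewrite (eq_bigr (fun _ => \prod_(s in J) w s * \det (gram b J))); last first.
  move=> f /andP[/injectiveP fi /eqP fJ].
  rewrite (det_sqr_gram b fJ fi); congr (_ * _).
  by rewrite -fJ big_imset //= => ? ? _ _; exact: fi.
rewrite sumr_const mulr_natl; congr (_ *+ _).
have -> : k`! = #|[set f : {ffun 'I_k -> S} in ffun_on J | injectiveb f]|.
  by rewrite card_inj_ffuns_on card_ord cJ ffactnn.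
apply: eq_card => f; rewrite !inE unfold_in andbC.
case: injectiveP => fi; rewrite ?andbF // !andbT.
apply/eqP/ffun_onP => [<- i|fJ]; first exact: imset_f.
apply/eqP; rewrite eqEcard card_imset // card_ord cJ leqnn andbT.
by apply/subsetP => _ /imsetP[i _ ->]; exact: fJ.
Qed.

End CauchyBinet.

(** * Network matrices *)

(** The type makes the result square, which [col_mx] alone does not. *)
Definition ones_over (R : pzSemiRingType) k (B : 'M[R]_(k, k.+1)) : 'M[R]_k.+1 :=
  col_mx (const_mx 1 : 'rV_k.+1) B.

Section Network.
Variable R : realDomainType.

Definition unimodular (d : R) := d \in [:: -1; 0; 1].

Lemma unimodularM d d' : unimodular d -> unimodular d' -> unimodular (d * d').
Proof.
rewrite /unimodular !inE => /or3P[] /eqP-> /or3P[] /eqP->;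
  by rewrite ?mulr0 ?mul0r ?mul1r ?mulr1 ?mulN1r ?opprK ?eqxx ?orbT.
Qed.

Lemma unimodular_sign m : unimodular ((-1) ^+ m).
Proof. by rewrite -signr_odd /unimodular !inE; case: odd; rewrite eqxx ?orbT. Qed.

(** A missing endpoint, [None], accounts for rows with a single nonzero entry and
    makes the class stable under the deletion of columns. *)
Definition network_row n (f : 'I_n -> R) : Prop :=
  exists a b : option 'I_n, forall j, f j = (a == Some j)%:R - (b == Some j)%:R.

Lemma network_row_lift n (f : 'I_n.+1 -> R) m :
  network_row f -> network_row (fun j => f (lift m j)).
Proof.
move=> [a [b fE]]; exists (obind (unlift m) a), (obind (unlift m) b) => j.
have E (x : option 'I_n.+1) :
    (obind (unlift m) x == Some j) = (x == Some (lift m j)).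
  case: x => [x|] //=; case: unliftP => [y ->|->].
    by rewrite !(inj_eq Some_inj) (inj_eq lift_inj).
  by rewrite (inj_eq Some_inj) (negPf (neq_lift m j)).
by rewrite fE !E.
Qed.

(** Total unimodularity.  If some row has at most one nonzero entry, expand along
    it; otherwise each row is the difference of two basis vectors, and the sum
    of the columns is zero. *)
Lemma det_network n (A : 'M[R]_n) :
  (forall i, network_row (A i)) -> unimodular (\det A).
Proof.
elim: n A => [|n IH] A netA; first by rewrite det_mx00 /unimodular !inE eqxx !orbT.
have expand i k c : unimodular c -> (forall j, A i j = c * (k == j)%:R) ->
    unimodular (\det A).
  move=> uc Ai; rewrite (expand_det_row _ i) (bigD1 k) //= big1 ?addr0; last first.
    by move=> j jk; rewrite Ai eq_sym (negPf jk) mulr0 mul0r.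
  rewrite Ai eqxx mulr1; apply: unimodularM => //; apply: unimodularM.
    exact: unimodular_sign.
  apply: IH => i'; have [a [b E]] := network_row_lift k (netA (lift i i')).
  by exists a, b => j; rewrite !mxE.
have [a /fin_all_exists[b Aab]] := fin_all_exists netA.
have [i|full] := pickP (fun i => ~~ (a i && b i)).
  have := Aab i; case: (a i) (b i) => [x|] [y|] //= Ai _.
  - apply: (expand i x 1) => [|j]; first exact: (unimodular_sign 0).
    by rewrite Ai subr0 mul1r.
  - apply: (expand i y (-1)) => [|j]; first exact: (unimodular_sign 1).
    by rewrite Ai sub0r mulN1r.
  - apply: (expand i 0 0) => [|j]; first by rewrite /unimodular !inE eqxx orbT.
    by rewrite Ai subr0 mul0r.
suff /eqP-> : \det A == 0 by rewrite /unimodular !inE eqxx orbT.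
rewrite -det_tr; apply/det0P; exists (const_mx 1).
  by apply/eqP => /rowP/(_ 0)/eqP; rewrite !mxE oner_eq0.
apply/rowP => i; rewrite !mxE.
under eq_bigr => j _ do rewrite !mxE mul1r Aab.
have one (x : option 'I_n.+1) : x -> \sum_j (x == Some j)%:R = 1 :> R.
  case: x => // x _; rewrite (bigD1 x) //= eqxx big1 ?addr0 // => j jx.
  by rewrite (inj_eq Some_inj) eq_sym (negPf jx).
by have /negbFE/andP[ai bi] := full i; rewrite sumrB !one ?subrr.
Qed.

(** A 1 and a -1 cannot both occur, as their difference would be 2: the sign e of
    the nonzero c i is constant, and then c i = e * c i ^+ 2. *)
Lemma normr_sum_unimodular (I : finType) (c : I -> R) :
    (forall i, unimodular (c i)) -> (forall i j, unimodular (c i - c j)) ->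
  `|\sum_i c i| = \sum_i c i ^+ 2.
Proof.
move=> uc ucB.
suff [e e1 ce] : exists2 e : R, `|e| = 1 & forall i, c i = e * c i ^+ 2.
  rewrite (eq_bigr _ (fun i _ => ce i)) -mulr_sumr normrM e1 mul1r ger0_norm //.
  by apply: sumr_ge0 => i _; exact: sqr_ge0.
have [i ci|c0] := pickP (fun i => c i != 0); last first.
  by exists 1 => [|i]; rewrite ?normr1 // (eqP (negbFE (c0 i))) expr0n mulr0.
have two : unimodular (1 + 1) = false.
  apply/negP; rewrite /unimodular !inE -mulr2n => /or3P[] /eqP E.
  - by have := ler0n R 2; rewrite E oppr_ge0 ler10.
  - by move/eqP: E; rewrite pnatr_eq0.
  - by move/eqP: E; rewrite pnatr_eq1.
exists (c i) => [|j].
  have := uc i; rewrite /unimodular !inE (negPf ci) /= => /orP[]/eqP->;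
  by rewrite ?normrN normr1.
have := ucB j i; have := ucB i j; have := uc j; have := uc i.
rewrite {1 2}/unimodular !inE (negPf ci) /= => /orP[]/eqP-> /or3P[] /eqP->;
by rewrite ?expr0n ?mulr0 ?sqrrN ?expr1n ?mulr1 // ?opprK two.
Qed.

Lemma expand_det_col_mx k (u : 'rV[R]_k.+1) (B : 'M[R]_(k, k.+1)) :
  \det (col_mx u B : 'M_k.+1) =
  \sum_m u 0 m * ((-1) ^+ m * \det (col' m B)).
Proof.
rewrite (expand_det_row _ 0); apply: eq_bigr => m _.
have -> : (0 : 'I_k.+1) = lshift k (0 : 'I_1) by exact: val_inj.
rewrite (col_mxEu u B); congr (_ * (_ * \det _)).
apply/matrixP => i j; rewrite [LHS]mxE [LHS]mxE [RHS]mxE.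
have -> : lift (lshift k (0 : 'I_1)) i = rshift 1 i by exact: val_inj.
by rewrite (col_mxEd u B).
Qed.

(** The summands are, up to sign, the cofactors of the row of 1s; a difference of
    two cofactors is the determinant with e_m - e_m' in place of that row. *)
Lemma normr_det_ones_network k (B : 'M[R]_(k, k.+1)) :
    (forall i, network_row (B i)) ->
  `|\det (ones_over B)| = \sum_m \det (col' m B) ^+ 2.
Proof.
move=> netB; pose c (m : 'I_k.+1) := (-1) ^+ m * \det (col' m B).
have -> : \det (ones_over B) = \sum_m c m.
  by rewrite expand_det_col_mx; apply: eq_bigr => m _; rewrite mxE mul1r.
rewrite normr_sum_unimodular.
- by apply: eq_bigr => m _; rewrite exprMn sqrr_sign mul1r.
- move=> m; apply: unimodularM; first exact: unimodular_sign.
  apply: det_network => i; have [a [b E]] := network_row_lift m (netB i).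
  by exists a, b => j; rewrite mxE.
- move=> m m'; pose u : 'rV[R]_k.+1 := delta_mx 0 m - delta_mx 0 m'.
  have -> : c m - c m' = \det (col_mx u B : 'M_k.+1).
    have delta x : \sum_j (j == x)%:R * c j = c x.
      rewrite (bigD1 x) //= eqxx mul1r big1 ?addr0 // => j /negPf->.
      by rewrite mul0r.
    rewrite expand_det_col_mx -(delta m) -(delta m') -sumrB.
    by apply: eq_bigr => j _; rewrite !mxE eqxx /= mulrBl.
  apply: det_network => i; rewrite -(@splitK 1 k i); case: (@split 1 k i) => i' /=.
    exists (Some m), (Some m') => j; rewrite (col_mxEu u B) !mxE ord1 eqxx /=.
    by rewrite !(inj_eq Some_inj) !(eq_sym j).
  by have [a [b E]] := netB i'; exists a, b => j; rewrite (col_mxEd u B).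
Qed.

End Network.

(** * Volumes of parallelepipeds orthogonal to the vector of 1s *)

Section Volume.
Variable R : realType.

(** The row of 1s is orthogonal to the rows of A, so that the Gram matrix of all
    the rows is block diagonal. *)
Lemma det_gram_ones k (A : 'M[R]_(k, k.+1)) :
    (forall i, \sum_j A i j = 0) ->
  k.+1%:R * \det (A *m A^T) = \det (ones_over A) ^+ 2.
Proof.
move=> A0; rewrite expr2 -[X in _ = _ * X]det_tr -det_mulmx.
have -> : ones_over A *m (ones_over A)^T =
   block_mx (k.+1%:R%:M : 'M_1) 0 0 (A *m A^T).
  rewrite /ones_over (tr_col_mx (const_mx 1 : 'rV_k.+1) A).
  rewrite (mul_col_row (const_mx 1 : 'rV_k.+1) A (const_mx 1 : 'rV_k.+1)^T A^T).
  congr (@block_mx R 1 k 1 k _ _ _ _); apply/matrixP => i j; rewrite !mxE.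
  - rewrite !ord1 mulr1n; under eq_bigr => l _ do rewrite !mxE mulr1.
    by rewrite sumr_const card_ord.
  - by under eq_bigr => l _ do rewrite !mxE mul1r.
  - by under eq_bigr => l _ do rewrite !mxE mulr1.
by rewrite (det_ublock (k.+1%:R%:M : 'M_1)) det_scalar1.
Qed.

Lemma det_ones_shear k (B : 'M[R]_(k, k.+1)) (c : 'rV[R]_k) (d : 'cV[R]_k) :
  \det (ones_over (diag_mx c *m B + d *m const_mx 1)) =
  (\prod_i c 0 i) * \det (ones_over B).
Proof.
have -> : (ones_over (diag_mx c *m B + d *m const_mx 1)) =
    block_mx (1%:M : 'M_1) 0 d (diag_mx c) *m ones_over B.
  rewrite /ones_over (mul_block_col 1%:M) mul1mx mul0mx addr0.
  by congr (@col_mx R 1 k k.+1 _ _); rewrite addrC.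
by rewrite det_mulmx (@det_lblock R 1 k 1%:M) det1 mul1r det_diag.
Qed.

(** For the cyclopermutohedron, v is R_i = n e_i - [ones] or e_j - e_i, and b is
    the network row e_i or e_j - e_i. *)
Lemma volume_network k (S : finType) (J : {set S})
    (v b : S -> 'rV[R]_k.+1) (c d : S -> R) :
    #|J| = k -> (forall s, \sum_j v s 0 j = 0) -> (forall s, 0 <= c s) ->
    (forall s, v s = c s *: b s + d s *: const_mx 1) ->
    (forall s, network_row (b s 0)) ->
  Num.sqrt k.+1%:R *
    parallelepiped_volume (\matrix_(i < #|J|) v (enum_val i)) =
  (\prod_(s in J) c s) * \sum_m \det (gram (fun s => col' m (b s)) J).
Proof.
move=> cJ v0 c0 vE netb; subst k.
pose e (i : 'I_#|J|) : S := enum_val i.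
rewrite /parallelepiped_volume -sqrtrM ?ler0n // det_gram_ones; last first.
  by move=> i; under eq_bigr => j _ do rewrite mxE; exact: v0.
rewrite sqrtr_sqr.
have -> : \matrix_(i < #|J|) v (enum_val i) =
    diag_mx (\row_i c (e i)) *m (\matrix_i b (e i)) +
    (\col_i d (e i)) *m const_mx 1.
  by apply/matrixP => i j; rewrite mul_diag_mx !mxE vE !mxE big_ord1 !mxE.
rewrite det_ones_shear normrM ger0_norm; last first.
  by apply: prodr_ge0 => i _; rewrite mxE.
have imJ : [ffun i => e i] @: 'I_#|J| = J.
  apply/setP => s; apply/imsetP/idP => [[i _ ->]|Js].
    by rewrite ffunE enum_valP.
  by exists (enum_rank_in Js s); rewrite // ffunE /e enum_rankK_in.
have inj_e : injective [ffun i => e i].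
  by move=> i j; rewrite !ffunE; exact: enum_val_inj.
congr (_ * _).
  transitivity (\prod_(s in [ffun i => e i] @: 'I_#|J|) c s); last by rewrite imJ.
  rewrite big_imset /=; last by move=> ? ? _ _; exact: inj_e.
  by apply: eq_bigr => i _; rewrite mxE ffunE.
rewrite normr_det_ones_network; last first.
  by move=> i; have [x [y E]] := netb (e i); exists x, y => j; rewrite mxE.
apply: eq_bigr => m _; rewrite -(det_sqr_gram _ imJ inj_e).
by congr (\det _ ^+ 2); apply/matrixP => i j; rewrite !mxE ffunE.
Qed.

End Volume.

(** * The cyclopermutohedron *)

Lemma sum_lt_pairs (R : nmodType) n (F : 'I_n -> 'I_n -> R) :
    (forall i j, F i j = F j i) -> (forall i, F i i = 0) ->
  (\sum_(p : {ij : 'I_n * 'I_n | (ij.1 < ij.2)%N}) F (val p).1 (val p).2) *+ 2 =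
  \sum_i \sum_j F i j.
Proof.
move=> Fsym F0.
have -> :
    \sum_(p : {ij : 'I_n * 'I_n | (ij.1 < ij.2)%N}) F (val p).1 (val p).2 =
    \sum_(i < n) \sum_(j < n | (i < j)%N) F i j.
  rewrite pair_big_dep /= [RHS](reindex_omap
    (fun p : {ij : 'I_n * 'I_n | (ij.1 < ij.2)%N} => val p) insub) /=; last first.
    by move=> p lt_p; rewrite insubT.
  by apply: eq_bigl => -[p lt_p] /=; rewrite insubT eqxx lt_p.
have swap : \sum_(i < n) \sum_(j < n | (i < j)%N) F i j =
    \sum_(i < n) \sum_(j < n | (j < i)%N) F i j.
  rewrite (exchange_big_dep xpredT) //=; apply: eq_bigr => i _.
  exact: eq_bigr.
rewrite mulr2n {2}swap -big_split; apply: eq_bigr => i _ /=.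
rewrite [RHS](bigID (fun j : 'I_n => (i < j)%N)) /=; congr (_ + _).
rewrite [RHS](bigD1 i) ?ltnn //= F0 add0r; apply: eq_bigl => j.
by rewrite -leqNgt ltn_neqAle andbC.
Qed.

Section Cyclopermutohedron.
Variables (R : realType) (n : nat).

Definition cp_row (s : cp_index n) : 'rV[R]_n :=
  match s with
  | inl ij => basis_vec R (val ij).2 - basis_vec R (val ij).1
  | inr i => basis_vec R i
  end.

Definition cp_scale (s : cp_index n) : R := if s is inl _ then 1 else n%:R.
Definition cp_shear (s : cp_index n) : R := if s is inl _ then 0 else -1.

Lemma cp_row_network s : network_row (cp_row s 0).
Proof.
case: s => [p|i] /=.
  exists (Some (val p).2), (Some (val p).1) => j.
  by rewrite !mxE eqxx /= !(inj_eq Some_inj) !(eq_sym j).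
by exists (Some i), None => j; rewrite !mxE eqxx subr0 (inj_eq Some_inj) eq_sym.
Qed.

(** The weight is 1 on an edge and -n on a vertex, so the sum is the (x, y) entry
    of the Laplacian of the complete graph minus n times the identity. *)
Lemma cp_sum_dyads x y :
  \sum_s cp_coef R s * cp_scale s * (cp_row s 0 x * cp_row s 0 y) = -1.
Proof.
have deltaE (i j : 'I_n) : basis_vec R i 0 j = (i == j)%:R.
  by rewrite mxE eqxx eq_sym.
rewrite big_sumType /=.
have sumd z : \sum_(i < n) (i == z)%:R = 1 :> R.
  by rewrite (bigD1 z) //= eqxx big1 ?addr0 // => i /negPf->.
have sumdd : \sum_(i < n) (i == x)%:R * (i == y)%:R = (x == y)%:R :> R.
  rewrite (bigD1 x) //= eqxx mul1r big1 ?addr0 // => i /negPf->; exact: mul0r.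
pose F (i j : 'I_n) : R :=
  ((j == x)%:R - (i == x)%:R) * ((j == y)%:R - (i == y)%:R).
have FE :
    \sum_(p : {ij : 'I_n * 'I_n | (ij.1 < ij.2)%N}) F (val p).1 (val p).2 =
    n%:R * (x == y)%:R - 1.
  have two : (2%:R : R) != 0 by rewrite pnatr_eq0.
  apply: (mulfI two); rewrite [LHS]mulr_natl sum_lt_pairs; last 2 first.
  - by move=> i j; rewrite /F; ring.
  - by move=> i; rewrite /F subrr mul0r.
  have inner i : \sum_j F i j = (x == y)%:R - (i == x)%:R - (i == y)%:R
      + n%:R * ((i == x)%:R * (i == y)%:R).
    rewrite /F; under eq_bigr => j _ do rewrite mulrBl !mulrBr opprB.
    rewrite big_split /= !sumrB sumdd -mulr_suml -mulr_sumr !sumd mul1r.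
    by rewrite -mulr_sumr sumd sumr_const card_ord -mulr_natl; ring.
  under eq_bigr => i _ do rewrite inner.
  rewrite big_split /= !sumrB -mulr_sumr sumdd !sumd sumr_const card_ord.
  by rewrite -[_ *+ n]mulr_natl; ring.
have -> : \sum_(p : {ij : 'I_n * 'I_n | (ij.1 < ij.2)%N}) 1 * 1 *
   ((basis_vec R (val p).2 - basis_vec R (val p).1) 0 x *
    (basis_vec R (val p).2 - basis_vec R (val p).1) 0 y) = n%:R * (x == y)%:R - 1.
  rewrite -FE; apply: eq_bigr => p _; rewrite !mul1r /F.
  by rewrite -!deltaE !mxE.
under eq_bigr => i _ do rewrite !deltaE mulN1r.
by rewrite -mulr_sumr sumdd mulNr addrAC subrr sub0r.
Qed.

End Cyclopermutohedron.

Theorem theorem1 (R : realType) (n : nat) (n_gt2 : (2 < n)%N) :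
  vz_volume (cyclopermutohedron R n) = 0.
Proof.
case: n n_gt2 => [//|k] k_gt1; rewrite ltnS in k_gt1.
have sqrtN0 : Num.sqrt (k.+1%:R : R) != 0 by rewrite lt0r_neq0 // sqrtr_gt0 ltr0n.
apply: (mulfI sqrtN0); rewrite mulr0 /vz_volume mulr_sumr /=.
have term (J : {set cp_index k.+1}) : #|J| = k ->
  Num.sqrt k.+1%:R * ((\prod_(s in J) cp_coef R s) * parallelepiped_volume
      (\matrix_(i < #|J|) vz_vector (Z := cyclopermutohedron R k.+1) (enum_val i))) =
  \sum_m (\prod_(s in J) (cp_coef R s * cp_scale R s)) *
         \det (gram (fun s => col' m (cp_row R s)) J).
  move=> cJ; rewrite mulrCA.
  rewrite (@volume_network _ _ _ _ _ (@cp_row R k.+1) (@cp_scale R k.+1)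
    (@cp_shear R k.+1)) //.
  - by rewrite mulrA -big_split /= mulr_sumr.
  - exact: cp_hyperplane.
  - by case=> [p|i] /=; rewrite ?ler01 ?ler0n.
  - case=> [p|i]; rewrite /vz_vector /=; first by rewrite scale1r scale0r addr0.
    by rewrite scaleN1r subr0.
  - exact: cp_row_network.
rewrite (eq_bigr _ (fun J cJ => term J (eqP cJ))) exchange_big /=.
apply: big1 => m _; rewrite -cauchy_binet.
(* All the entries are -1, and there are two distinct rows because k >= 2. *)
apply: (determinant_alternate (i1 := Ordinal (ltnW k_gt1))
                              (i2 := Ordinal k_gt1)) => // j.
have entry i : (\sum_s (cp_coef R s * cp_scale R s) *:
     ((col' m (cp_row R s))^T *m col' m (cp_row R s))) i j = -1.
  rewrite summxE -(cp_sum_dyads R (lift m i) (lift m j)); apply: eq_bigr => s _.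
  by rewrite !mxE big_ord1 !mxE.
by rewrite !entry.
Qed.
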